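(* Let $G$ be a connected $(P_5,\text{diamond})$-free graph. Then $cop(G)\leq 2$.
   Context: All graphs are finite, simple and undirected. $P_n$ denotes the path on $n$ vertices. The diamond is $K_4$ minus one edge. A graph is $(H_1,\dots,H_k)$-free if it contains no induced subgraph isomorphic to any $H_i$. Game of cops and robber on a connected graph: first all cops are placed on vertices (several may share a vertex), then the robber chooses a vertex; afterwards cops and robber move alternately, starting with the cops, a move consisting of staying put or moving to an adjacent vertex. The cops win if after finitely many rounds some cop is on the same vertex as the robber. The cop number $cop(G)$ is the minimum number of cops that guarantees a win in each connected component of $G$. *)

(* Defs.v *)
From mathcomp Require Import all_boot.
From mathcomp Require Import boolp.

Set Implicit Arguments.
Unset Strict Implicit.
Unset Printing Implicit Defensive.

Record sgraph := SGraph {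
  vertex :> finType;
  adj : rel vertex;
  adj_sym : symmetric adj;
  adj_irr : irreflexive adj }.

Definition connected_graph (G : sgraph) : Prop :=
  forall x y : G, connect (@adj G) x y.

Definition contains_induced (H G : sgraph) : Prop :=
  exists f : H -> G, injective f /\ forall x y, adj (f x) (f y) = adj x y.

Definition induced_free (H G : sgraph) : Prop := ~ contains_induced H G.

Definition path_rel n : rel 'I_n :=
  fun i j => (i.+1 == j :> nat) || (j.+1 == i :> nat).

Lemma path_rel_sym n : symmetric (@path_rel n).
Proof. by move=> i j; rewrite /path_rel orbC. Qed.

Lemma path_rel_irr n : irreflexive (@path_rel n).
Proof. by move=> i; rewrite /path_rel orbb gtn_eqF. Qed.

Definition path_graph n : sgraph := SGraph (@path_rel_sym n) (@path_rel_irr n).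

(* The missing edge is {0, 1}. *)
Definition diamond_rel : rel 'I_4 :=
  fun i j => (i != j) && ~~ ((i < 2) && (j < 2)).

Lemma diamond_rel_sym : symmetric diamond_rel.
Proof. by move=> i j; rewrite /diamond_rel eq_sym [(i < 2) && _]andbC. Qed.

Lemma diamond_rel_irr : irreflexive diamond_rel.
Proof. by move=> i; rewrite /diamond_rel eqxx. Qed.

Definition diamond : sgraph := SGraph diamond_rel_sym diamond_rel_irr.

Section CopsAndRobber.
Variable G : sgraph.

Definition step (u v : G) : bool := (u == v) || adj u v.

(* A strategy for k cops maps the list of the robber's positions so far, in
   chronological order, to the positions of the cops after their reply; its
   value at the empty list is the initial placement. *)
Definition cop_strategy (k : nat) := seq G -> 'I_k -> G.

(* The game is played inside a set C of vertices, to be instantiated by a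
   connected component: only the initial choices have to be restricted to C,
   since no move leaves a component. *)
Definition legal_strategy (C : pred G) k (s : cop_strategy k) : Prop :=
  (forall i, C (s [::] i)) /\
  (forall h r i, step (s h i) (s (rcons h r) i)).

Definition legal_robber (C : pred G) (r : nat -> G) : Prop :=
  C (r 0) /\ forall n, step (r n) (r n.+1).

(* When the robber arrives at r n, the cops have seen r 0, ..., r n.-1; they
   then move, having seen r n as well. The robber is caught if a cop is on
   his vertex at one of these two moments, for some n. *)
Definition captures k (s : cop_strategy k) (r : nat -> G) : Prop :=
  exists n i, s (mkseq r n) i = r n \/ s (mkseq r n.+1) i = r n.

Definition cops_win_on (C : pred G) (k : nat) : Prop :=
  exists s : cop_strategy k,
    legal_strategy C s /\ forall r, legal_robber C r -> captures s r.

Definition cops_suffice (k : nat) : Prop :=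
  forall x : G, cops_win_on (connect (@adj G) x) k.

Lemma cops_suffice_exists : exists k, `[< cops_suffice k >].
Proof.
exists #|G|; apply/asboolP => x; set C := connect _ x.
exists (fun _ i => if C (enum_val i) then enum_val i else x); split.
  split=> [i|h r i]; last by rewrite /step eqxx.
  by case: ifP => // _; apply: connect0.
move=> r [Cr0 _]; exists 0, (enum_rank (r 0)); left.
by rewrite enum_rankK Cr0.
Qed.

Definition cop_number : nat := ex_minn cops_suffice_exists.

End CopsAndRobber.

(* Main.v *)
(* Induct on the number of vertices. If N(x) is contained in N[y] for some
   y <> x, then G - x is a retract of G: two cops chase the image of the robber
   in G - x and thereby either catch him or pin him at x.
   Otherwise put both cops on an arbitrary vertex v. As G is P5-free, there is
   a neighbour u of v such that, once the second cop has moved to u, the robber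
   stays within distance two of u as long as he avoids N[v]. When he stands at
   b, the cops look for a trap: vertices c in N[v] and d in N[u] such that
   N[b] is covered by N[c] and N[d]. If no trap exists, u and b have two
   nonadjacent common neighbours outside N(v), and adding the few witnesses of
   the absence of traps and of dominated vertices always creates an induced P5
   or diamond. *)
Require Import Defs.
From mathcomp Require Import all_boot boolp.

Set Implicit Arguments.
Unset Strict Implicit.
Unset Printing Implicit Defensive.

(** * Working with the two forbidden subgraphs *)

Section ForbiddenSubgraphs.
Variable G : sgraph.
Hypothesis GP5 : induced_free (path_graph 5) G.
Hypothesis Gdiamond : induced_free diamond G.
Implicit Types x y z : G.

Lemma P5_free x1 x2 x3 x4 x5 :
    adj x1 x2 -> adj x2 x3 -> adj x3 x4 -> adj x4 x5 ->
    adj x1 x3 = false -> adj x1 x4 = false -> adj x1 x5 = false ->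
    adj x2 x4 = false -> adj x2 x5 = false -> adj x3 x5 = false ->
  False.
Proof.
move=> a12 a23 a34 a45 n13 n14 n15 n24 n25 n35; apply: GP5.
pose f (i : 'I_5) := tnth [tuple x1; x2; x3; x4; x5] i; exists f.
have fadj i j : adj (f i) (f j) = path_rel i j.
  case: i j => -[|[|[|[|[|//]]]]] i5 [[|[|[|[|[|//]]]]] j5];
    rewrite /f !(tnth_nth x1) /=;
    by [rewrite ?adj_irr | rewrite ?(a12, a23, a34, a45) | rewrite adj_sym].
split=> // i j fij.
(* Distinct vertices of P5 have distinct neighbourhoods, so the adjacencies alone make [f]
   injective. *)
have: forall k, path_rel i k = path_rel j k by move=> k; rewrite -!fadj fij.
case: i j {fij} => -[|[|[|[|[|//]]]]] i5 [[|[|[|[|[|//]]]]] j5] eq_ij;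
  apply: val_inj => //=;
  by have := (eq_ij (inord 0), eq_ij (inord 1), eq_ij (inord 2),
              eq_ij (inord 3), eq_ij (inord 4));
     rewrite /path_rel /= !inordK //; case; case; case; case.
Qed.

(** The two ends of the missing edge have the same neighbours in the diamond, so, unlike for P5,
    their distinctness has to be assumed. *)
Lemma diamond_free x1 x2 x3 x4 :
    x1 <> x2 -> adj x1 x2 = false -> adj x3 x4 ->
    adj x1 x3 -> adj x1 x4 -> adj x2 x3 -> adj x2 x4 ->
  False.
Proof.
move=> x12 n12 a34 a13 a14 a23 a24; apply: Gdiamond.
pose f (i : 'I_4) := tnth [tuple x1; x2; x3; x4] i; exists f.
have fadj i j : adj (f i) (f j) = diamond_rel i j.
  case: i j => -[|[|[|[|//]]]] i4 [[|[|[|[|//]]]] j4];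
    rewrite /f !(tnth_nth x1) /=;
    by [rewrite ?adj_irr | rewrite ?(a13, a14, a23, a24, a34)
       | rewrite adj_sym].
split=> // i j fij; move: (fadj i j) fij; rewrite /f !(tnth_nth x1) => aij fij.
move: aij; rewrite fij adj_irr; move: fij.
case: i j => -[|[|[|[|//]]]] i4 [[|[|[|[|//]]]] j4] //= fij _;
  by [apply: val_inj | case: x12].
Qed.

Ltac adj_symmetrize := repeat match goal with
  | H : is_true (@adj ?G ?a ?b) |- _ =>
    lazymatch goal with
    | _ : @adj G a b = _ |- _ => fail
    | _ => have ?: @adj G a b = true by exact: H
    end
  | H : @adj ?G ?a ?b = ?c |- _ =>
    lazymatch goal with
    | _ : @adj G b a = _ |- _ => fail
    | _ => have ?: @adj G b a = c by rewrite adj_sym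
    end
  end.

Lemma adj_neq x y z : adj x z -> adj y z = false -> x <> y.
Proof. by move=> xz yz xy; rewrite xy yz in xz. Qed.

Ltac distinct := first
  [ assumption | apply: nesym; assumption
  | match goal with H : adj ?x ?z = true, H' : adj ?y ?z = false |- _ =>
      first [exact: (@adj_neq x y z) | exact: (nesym (@adj_neq x y z H H'))]
    end ].

(** Closes a branch whose recorded adjacencies clash or exhibit an induced diamond or P5; after
    [adj_case] only branches where none of these is found remain. *)
Ltac forbidden := exfalso; match goal with
  | H : adj ?x ?y = true, H' : adj ?x ?y = false |- _ => by rewrite H in H'
  | H34 : adj ?x3 ?x4 = true, H13 : adj ?x1 ?x3 = true,
    H14 : adj ?x1 ?x4 = true, H12 : adj ?x1 ?x2 = false,
    H23 : adj ?x2 ?x3 = true, H24 : adj ?x2 ?x4 = true |- _ =>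
    apply: (@diamond_free x1 x2 x3 x4) => //; distinct
  | H12 : adj ?x1 ?x2 = true, H23 : adj ?x2 ?x3 = true,
    H13 : adj ?x1 ?x3 = false, H34 : adj ?x3 ?x4 = true,
    H14 : adj ?x1 ?x4 = false, H24 : adj ?x2 ?x4 = false,
    H45 : adj ?x4 ?x5 = true, H15 : adj ?x1 ?x5 = false,
    H25 : adj ?x2 ?x5 = false, H35 : adj ?x3 ?x5 = false |- _ =>
    exact: (@P5_free x1 x2 x3 x4 x5)
  end.

Ltac adj_case x y := let E := fresh "E" in
  case E : (adj x y); adj_symmetrize; try forbidden.

(** * Contradiction from the absence of traps *)

Section Trap.
Hypothesis dom_free :
  forall x y, x <> y -> exists z, [/\ adj x z, adj y z = false & z <> y].
Variables v u b : G.
Hypotheses (uv : adj u v) (bv : adj b v = false) (bu : adj b u = false).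
Hypothesis no_trap : forall c d, step v c -> step u d -> adj c b || adj d b ->
  exists z, [/\ adj b z, adj c z = false, adj d z = false, z <> c & z <> d].

Ltac trap_side := rewrite /step;
  repeat match goal with H : adj _ _ = _ |- _ => rewrite H end;
  rewrite ?orbT //.

(** Here [b], [a1], [z] form a triangle. The adjacencies of the new witnesses [t] and [s] to the
    earlier vertices are forced, and for [q] no choice is left. *)
Lemma no_trap_triangle a1 a2 y z :
    adj v a1 = false -> adj u a1 -> adj b a1 ->
    adj v a2 = false -> adj u a2 -> adj b a2 -> adj a1 a2 = false ->
    adj v y -> adj u y = false -> adj b y -> adj a1 y = false ->
    adj a2 y = false -> adj v z -> adj u z = false -> adj b z ->
    adj a1 z -> adj a2 z = false ->
  False.
Proof.
move=> *; adj_symmetrize.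
adj_case y z.
have [|t [a2t a1t t'a1]] := @dom_free a2 a1; first distinct.
adj_symmetrize.
adj_case t v; adj_case t u; adj_case t b; adj_case t y; adj_case t z.
(* The only surviving [t] is adjacent to [u], [y] and [z], so the cops could move to [z] and [t]. *)
have [|||s [bs zs ts s'z s't]] := @no_trap z t; try by trap_side.
adj_symmetrize.
adj_case s v; adj_case s u; adj_case s a1; adj_case s a2; adj_case s y.
(* As [t] is adjacent to [u], [y] and [z], the witness [q] is a further neighbour of [v]. *)
have [|q [vq tq q't]] := @dom_free v t; first distinct.
adj_symmetrize.
by adj_case q u; adj_case q b; adj_case q a1; adj_case q a2; adj_case q y;
  adj_case q z; adj_case q s.
Qed.

Lemma no_trap_contradiction a1 a2 : a1 <> a2 ->
    adj v a1 = false -> adj u a1 -> adj b a1 ->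
    adj v a2 = false -> adj u a2 -> adj b a2 -> adj a1 a2 = false ->
  False.
Proof.
move=> *; adj_symmetrize.
(* This [y] is adjacent to [v], since otherwise [v], [u], [a1], [b], [y] is an induced P5. *)
have [|||y [? ? ? ? ?]] := @no_trap u a1; try by trap_side.
adj_symmetrize; adj_case y v.
adj_case y a2.
  have [|||y' [? ? ? ? ?]] := @no_trap u a2; try by trap_side.
  adj_symmetrize; adj_case y' v; adj_case y' a1; adj_case y' y.
  exact: (@no_trap_triangle a2 a1 y' y).
have [|z [? ? ?]] := @dom_free a1 a2; first distinct.
adj_symmetrize; adj_case z v; adj_case z u; adj_case z b; adj_case z y.
  exact: (@no_trap_triangle a1 a2 y z).
(* In the remaining case [z] is adjacent to [u] and [y] but to neither [v] nor [b]. *)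
have [|t [? ? ?]] := @dom_free v z; first distinct.
adj_symmetrize; adj_case t u; adj_case t b; adj_case t a1; adj_case t a2;
  adj_case t y.
have [|||s [? ? ? ? ?]] := @no_trap t a2; try by trap_side.
adj_symmetrize.
by adj_case s v; adj_case s u; adj_case s a1; adj_case s y; adj_case s z.
Qed.
End Trap.
End ForbiddenSubgraphs.

(** * The game with two cops as an inductive predicate *)

Section Game.
Variable G : sgraph.
Implicit Types (c d r x y z : G).

Lemma step_refl x : step x x. Proof. by rewrite /step eqxx. Qed.

Lemma step_sym x y : step x y = step y x.
Proof. by rewrite /step eq_sym adj_sym. Qed.

Lemma adj_step x y : adj x y -> step x y.
Proof. by rewrite /step => ->; rewrite orbT. Qed.

Lemma notstepP x y : step x y = false -> adj x y = false /\ y <> x.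
Proof.
by rewrite /step => /norP[/eqP xy /negbTE]; split=> //; apply: nesym.
Qed.

(* It is the cops' turn. *)
Inductive win c d r : Prop :=
| WinCatch c' d' of step c c' & step d d' & c' = r \/ d' = r
| WinMove c' d' of step c c' & step d d' &
    forall r', step r r' -> win c' d' r'.

Lemma win_catch_l c d r : step c r -> win c d r.
Proof.
by move=> cr; apply: (@WinCatch c d r r d) => //; [exact: step_refl | left].
Qed.

Lemma win_sym c d r : win c d r -> win d c r.
Proof.
elim=> {}c {}d {}r c' d' cc' dd'.
  by case=> e; apply: (@WinCatch d c r d' c') => //; [right | left].
by move=> _ IH; apply: (@WinMove d c r d' c').
Qed.

Lemma win_catch_r c d r : step d r -> win c d r.
Proof. by move=> dr; apply/win_sym/win_catch_l. Qed.

Lemma win_trap c d r c' d' : step c c' -> step d d' ->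
  (forall r', step r r' -> step c' r' || step d' r') -> win c d r.
Proof.
move=> cc' dd' H; apply: (@WinMove c d r c' d') => // r' /H.
by case/orP => [/win_catch_l | /win_catch_r]; apply.
Qed.

(** The first cop waits while the second follows a path to [d']; what the robber does meanwhile is
    irrelevant, as every position of his is lost then. *)
Lemma win_walk c d d' : connect (@adj G) d d' ->
  (forall r, win c d' r) -> forall r, win c d r.
Proof.
case/connectP=> p.
elim: p d => [|e p IH] d /= => [_ -> // | /andP[de pe] le W r].
apply: (@WinMove c d r c e) => [||r' _]; [exact: step_refl | exact: adj_step |].
exact: IH.
Qed.

(** A robber leaving [r] is caught at once by the first cop, so he can only wait there for the
    second one. *)
Lemma win_pinned c d r : connect (@adj G) d r ->
  (forall z, adj r z -> step c z) -> win c d r.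
Proof.
case/connectP=> p.
elim: p d => [|e p IH] d /= => [_ <- _ | /andP[de pe] le W].
  exact/win_catch_r/step_refl.
apply: (@WinMove c d r c e) => [||r' /orP[/eqP<-|/W]].
- exact: step_refl.
- exact: adj_step.
- exact: IH.
- exact: win_catch_l.
Qed.

(* Choosing moves that win within a decreasing number of rounds ensures that
   the strategy makes progress: a winning move alone may lead back. *)
Fixpoint win_in n c d r : bool :=
  [exists m : G * G, [&& step c m.1, step d m.2 &
    [|| m.1 == r, m.2 == r |
     if n is n'.+1 then [forall r', step r r' ==> win_in n' m.1 m.2 r']
     else false]]].

Lemma win_in_leq n n' c d r : n <= n' -> win_in n c d r -> win_in n' c d r.
Proof.
elim: n n' c d r => [|n IH] [|n'] c d r //= nn' /existsP[m /and3P[cm dm H]];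
  apply/existsP; exists m; rewrite cm dm /=;
  case/or3P: H => [->|->|//]; rewrite ?orbT //.
move=> /forallP H; apply/or3P/Or33/forallP=> r'; apply/implyP=> rr'.
by apply: IH => //; have /implyP := H r'; apply.
Qed.

(** The finitely many robber positions have a largest bound, and [win_in] is monotone in its
    bound. *)
Lemma uniform_win_in (P : pred G) c d :
  (forall r, P r -> exists n, win_in n c d r) ->
  exists n, forall r, P r -> win_in n c d r.
Proof.
move=> H.
have [|f Hf] := @fin_all_exists _ _ (fun r n => P r -> win_in n c d r).
  by move=> r; case Pr: (P r); [have [n] := H r Pr; exists n | exists 0].
exists (\max_r f r) => r /Hf; exact/win_in_leq/leq_bigmax.
Qed.

Lemma win_win_in c d r : win c d r -> exists n, win_in n c d r.
Proof.
elim=> {}c {}d {}r c' d' cc' dd'.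
  move=> H; exists 0; apply/existsP; exists (c', d'); rewrite cc' dd' /=.
  by case: H => ->; rewrite eqxx ?orbT.
move=> _ /uniform_win_in[n Hn]; exists n.+1; apply/existsP; exists (c', d').
rewrite cc' dd' /=; apply/or3P/Or33/forallP=> r'; exact/implyP/Hn.
Qed.

Lemma cops_win_on2 (C : pred G) c d : C c -> C d ->
  (forall r, win c d r) -> cops_win_on C 2.
Proof.
move=> Cc Cd W.
have [|N WN] := @uniform_win_in predT c d.
  by move=> r _; apply: win_win_in.
pose good n r (m : G * G) := [|| m.1 == r, m.2 == r |
  if n is n'.+1 then [forall r', step r r' ==> win_in n' m.1 m.2 r']
  else false].
have /choice[mv mvP] (q : nat * (G * G) * G) : exists m : G * G,
    let: (n, (x, y), r) := q in
    [/\ step x m.1, step y m.2 & win_in n x y r -> good n r m].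
  case: q => [[n [x y]] r]; case E: (win_in n x y r).
    by case: n E => [|n] /existsP[m /and3P[xm ym gm]]; exists m.
  (* From positions outside [win_in] the cops stay put, because a strategy must be legal on every
     history. *)
  by exists (x, y); rewrite !step_refl.
(* The state consists of the rounds left and the cops' positions; folding over the history makes it
   a function of that history. *)
pose next q r := (q.1.-1, mv (q, r)).
pose state := foldl next (N, (c, d)).
pose s h (i : 'I_2) := if i == ord0 then (state h).2.1 else (state h).2.2.
have stateS h r : state (rcons h r) = next (state h) r by apply: foldl_rcons.
exists s; split=> [|r [_ rstep]].
  split=> [i|h r i]; first by rewrite /s; case: ifP.
  rewrite /s stateS; case: (state h) => n [x y] /=.
  by have [? ? _] := mvP (n, (x, y), r); case: ifP.
(* Induction on the rounds left: each reply catches the robber or keeps [win_in] with a smaller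
   bound. *)
suff cap n : forall k, (state (mkseq r k)).1 = n ->
    win_in n (state (mkseq r k)).2.1 (state (mkseq r k)).2.2 (r k) ->
    captures s r.
  by apply: (cap N 0) => //; apply: WN.
have caught k m : (state (mkseq r k.+1)).2 = m ->
    (m.1 == r k) || (m.2 == r k) -> captures s r.
  move=> <- /orP[/eqP e|/eqP e]; exists k.
    by exists ord0; right.
  by exists ord_max; right.
elim: n => [|n IH] k; have := mkseqS r k; move: (mkseq r k) => h.
all: have := stateS h (r k); case: (state h) => [n' [x y]] /= Sh hk n'E W0.
all: rewrite -hk in Sh; have [_ _] := mvP (n', (x, y), r k).
all: rewrite {}n'E in Sh * => /(_ W0).
  by rewrite /good orbF; apply: caught (congr1 snd Sh).
rewrite /good orbA => /orP[/(caught _ _ (congr1 snd Sh)) // | /forallP m_rk].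
by apply: (IH k.+1); rewrite Sh //; apply: (implyP (m_rk _)).
Qed.
End Game.

(** * Retraction onto the graph without a dominated vertex *)

Section Retract.
Variables (G : sgraph) (x y : G).
Hypotheses (xy : y != x) (Nxy : forall z, adj x z -> step y z).
Hypothesis Gconn : connected_graph G.

Definition del_vertex := {z : G | z != x}.
Definition del_rel : rel del_vertex := relpre val (@adj G).
Lemma del_sym : symmetric del_rel. Proof. by move=> z w; apply: adj_sym. Qed.
Lemma del_irr : irreflexive del_rel. Proof. by move=> z; apply: adj_irr. Qed.
Definition del_graph : sgraph := SGraph del_sym del_irr.

(** The default value of [insubd] is the image [y] of [x]; all other vertices are fixed. *)
Definition del_retract (z : G) : del_graph := insubd (Sub y xy : del_vertex) z.

Lemma del_retractE z : z != x -> val (del_retract z) = z.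
Proof. by move=> zx; rewrite val_insubd zx. Qed.

Lemma del_retractx : val (del_retract x) = y.
Proof. by rewrite val_insubd eqxx. Qed.

Lemma step_del (z w : del_graph) : step z w = step (val z) (val w).
Proof. by []. Qed.

Lemma del_retract_step z w : step z w -> step (del_retract z) (del_retract w).
Proof.
rewrite step_del; have [->|zx] := eqVneq z x; have [->|wx] := eqVneq w x;
  rewrite ?step_refl // ?del_retractx ?(del_retractE zx) ?(del_retractE wx) //.
- by rewrite {1}/step eq_sym (negbTE wx) => /Nxy.
- by rewrite step_sym {1}/step eq_sym (negbTE zx) => /Nxy; rewrite step_sym.
Qed.

(** The retraction turns a walk of G into a walk of G - x, up to repeated vertices. *)
Lemma del_connected : connected_graph del_graph.
Proof.
move=> a b; have valK (z : del_graph) : del_retract (val z) = z.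
  by apply/val_inj/del_retractE; exact: (valP (z : del_vertex)).
rewrite -(valK a) -(valK b); case/connectP: (Gconn (val a) (val b)) => p + ->.
elim: p (val a) => [|e p IH] w /=; first by rewrite connect0.
case/andP => /adj_step/del_retract_step/orP[/eqP-> //| we] /IH.
  exact.
by apply: connect_trans; apply: connect1.
Qed.

Lemma del_induced_free H : induced_free H G -> induced_free H del_graph.
Proof.
move=> HG [f [fI fa]]; apply: HG; exists (val \o f); split=> //.
by apply: inj_comp fI; apply: val_inj.
Qed.

Lemma card_del_graph : #|del_graph| < #|G|.
Proof. by rewrite card_sig cardC1 ltn_predL; apply/card_gt0P; exists x. Qed.

Lemma win_retract (c d : del_graph) r :
  win c d (del_retract r) -> win (val c) (val d) r.
Proof.
move er: (del_retract r) => r' W.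
elim: W r er => {}c {}d {}r' c' d' cc' dd'; last first.
  move=> _ IH r er; apply: (@WinMove _ _ _ _ (val c') (val d')) => // s rs.
  by apply: IH erefl; rewrite -er del_retract_step.
(* A catching move in G - x becomes an ordinary move in G, after which the robber goes from [r] to
   [s]. If [r] is not [x], the cop at [e] stood on [r] and can follow to [s]; if [r] is [x], he
   stands at [y] and the robber is caught or pinned at [x]. *)
have pinned (e f : G) r : e = val (del_retract r) ->
    forall s, step r s -> win e f s.
  have [->|rx] := eqVneq r x; last first.
    by rewrite del_retractE // => -> s; apply: win_catch_l.
  rewrite del_retractx => -> s /orP[/eqP<-|/Nxy]; last exact: win_catch_l.
  exact: win_pinned.
move=> H r er; apply: (@WinMove _ _ _ _ (val c') (val d')) => // s rs.
case: H => e; first by apply: pinned rs; rewrite er e.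
by apply/win_sym; apply: pinned rs; rewrite er e.
Qed.
End Retract.

(** * Keeping the robber within distance two *)

Section Distance.
Variable G : sgraph.
Hypothesis GP5 : induced_free (path_graph 5) G.
Hypothesis Gconn : connected_graph G.
Implicit Types u v r z : G.

(** In the second case the middle vertex lies outside N(v), so that [v], [u], [a], [r] can begin an
    induced path. *)
Definition near v u r :=
  adj u r \/ exists a, [/\ adj v a = false, adj u a & adj a r].

(** If the robber got away, [v], [u], [a], [r], [r'] would be an induced P5. *)
Lemma near_step v u r r' : adj v u -> adj v r = false -> adj v r' = false ->
  step r r' -> near v u r -> near v u r'.
Proof.
move=> vu vr vr' /orP[/eqP<- //|rr'] [ur|[a [va ua ar]]].
  by right; exists r.
case ur': (adj u r'); first by left.
case ar': (adj a r'); first by right; exists a.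
case ur: (adj u r); first by right; exists r.
by case: (@P5_free G GP5 v u a r r').
Qed.

(** A walk from [v] to [r] is treated like a walk of the robber: whenever it leaves N[v], [u] is its
    last vertex in N(v), and [near_step] keeps this [u] until the walk returns. *)
Lemma exists_near v r : step v r \/ exists2 u, adj v u & near v u r.
Proof.
have /connectP[p] := Gconn v r; elim/last_ind: p r => [|p z IH] r.
  by move=> _ ->; left; apply: step_refl.
rewrite rcons_path last_rcons => /andP[vp lz] ->.
case vz: (step v z); [by left | right].
have [vzF _] := notstepP vz.
case: (IH _ vp erefl) => [/orP[/eqP e|vl]|[u vu nu]].
- by rewrite e lz in vzF.
- by exists (last v p) => //; left.
case vl: (adj v (last v p)); first by exists (last v p) => //; left.
by exists u => //; apply: near_step nu => //; apply: adj_step.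
Qed.
End Distance.

(** * Graphs without dominated vertices *)

Section Undominated.
Variable G : sgraph.
Hypothesis GP5 : induced_free (path_graph 5) G.
Hypothesis Gdiamond : induced_free diamond G.
Hypothesis Gconn : connected_graph G.
Hypothesis dom_free :
  forall x y : G, x <> y -> exists z, [/\ adj x z, adj y z = false & z <> y].

Lemma win_near (v u b : G) : adj v u -> near v u b -> win v u b.
Proof.
move=> vu nb.
case vb: (step v b); first exact: win_catch_l.
case ub: (step u b); first exact: win_catch_r.
have [[/[dup] vbF + _] [/[dup] ubF + _]] := (notstepP vb, notstepP ub).
rewrite adj_sym => bv; rewrite adj_sym => bu.
case: nb => [|[a [va ua ab]]]; first by rewrite ubF.
have [[[c d] /and3P[/= vc ud /forallP t]]|nt] := pselect (exists m : G * G,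
    [&& step v m.1, step u m.2 &
     [forall z, step b z ==> step m.1 z || step m.2 z]]).
  by apply: (win_trap vc ud) => z; apply/implyP.
have no_trap c d : step v c -> step u d ->
    exists z, [/\ step b z, step c z = false & step d z = false].
  move=> vc ud; apply: contra_notP nt => nz; exists (c, d); rewrite vc ud /=.
  apply/forallP=> z; apply/implyP=> bz; apply: contra_notT nz => /norP[? ?].
  by exists z; split=> //; apply/negbTE.
exfalso.
(* Since [v] and [a] form no trap, there is [a'], which yields with [a] the nonadjacent common
   neighbours of [u] and [b]; P5-freeness makes [a'] adjacent to [u]. *)
have [a' [+ /notstepP[va' a'v] /notstepP[aa' a'a]]] :=
  no_trap v a (step_refl _) (adj_step ua).
case/orP => [/eqP e|ba']; first by rewrite -e ab in aa'.
have ua' : adj u a'.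
  by case ua' : (adj u a') => //; case: (@P5_free G GP5 v u a b a').
apply: (@no_trap_contradiction _ GP5 Gdiamond dom_free v u b _ _ _ _ a a')
  => //.
- by rewrite adj_sym.
- move=> c d /no_trap/[apply] -[z [+ /notstepP[cz zc] /notstepP[dz zd]]] cdb.
  (* The witness is not [b] itself, because [c] or [d] is adjacent to [b]. *)
  case/orP => [/eqP e|bz].
    by rewrite -e in cz dz; rewrite cz dz in cdb.
  by exists z.
- exact: nesym.
- by rewrite adj_sym.
Qed.

Lemma win_undominated (c d r : G) : win c d r.
Proof.
(* The second cop first joins the other at [c], from where one move takes him to a [u] chosen for
   the robber's position. *)
apply: win_walk r; first exact: Gconn d c.
move=> r; case cr: (step c r); first exact: win_catch_l.
have [cr0 _] := notstepP cr.
case: (exists_near GP5 Gconn c r) => [|[u cu nu]]; first by rewrite cr.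
apply: (@WinMove _ _ _ _ c u); [exact: step_refl | exact: adj_step |].
move=> r' rr'; case cr': (step c r'); first exact: win_catch_l.
have [cr'0 _] := notstepP cr'.
by apply: win_near => //; apply: near_step nu.
Qed.
End Undominated.

(** * Induction on the number of vertices *)

Lemma two_cops_win (G : sgraph) : connected_graph G ->
    induced_free (path_graph 5) G -> induced_free diamond G ->
  forall c d r : G, win c d r.
Proof.
have [n] := ubnP #|G|; elim: n G => // n IH G Gn Gconn GP5 Gdiamond.
have [[x [y [xy Nxy]]]|dom_free] := pselect (exists x y : G,
    y != x /\ forall z, adj x z -> step y z); last first.
  apply: win_undominated => // x y xy; apply: contra_notP dom_free => nz.
  exists x, y; split; first by apply/eqP/nesym.
  move=> z xz; apply: contra_notT nz => /norP[/eqP yz /negbTE ayz].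
  by exists z; split=> //; apply: nesym.
have W (c' d' r' : del_graph x) : win c' d' r'.
  apply: IH.
  - exact: leq_trans (card_del_graph x) _.
  - exact: del_connected xy Nxy Gconn.
  - exact: del_induced_free.
  - exact: del_induced_free.
pose y' := del_retract xy y => c d.
(* Both cops walk to [y], one after the other, so that they start in G - x. *)
apply: (@win_walk _ c d (val y')); first exact: Gconn.
move=> r; apply/win_sym; apply: (@win_walk _ _ c (val y')) r.
  exact: Gconn.
by move=> r; exact: (win_retract Nxy Gconn (W y' y' (del_retract xy r))).
Qed.

Theorem theorem6p1p1 (G : sgraph) (Gconn : connected_graph G)
    (GP5 : induced_free (path_graph 5) G) (Gdiamond : induced_free diamond G) :
  cop_number G <= 2.
Proof.
rewrite /cop_number; case: ex_minnP => m _; apply; apply/asboolP => x.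
by apply: (@cops_win_on2 _ _ x x) => // r; apply: two_cops_win.
Qed.
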